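(* There exist a universal polynomial $P$ in two variables and a universal constant $C<\infty$ (independent of $K$, $m$, $\alpha_{\min}$ and all other model primitives) such that the following holds. Consider the closed-network joint entry-assignment model described in the context with $m=|V|>1$ nodes, a horizon $T$, and any sequence of demand arrival rates $\{\boldsymbol\phi^t\}_{1\le t\le T}$ such that $\alpha(\boldsymbol\phi^t)>0$ for every $1\le t\le T$ and which varies $\eta$-slowly over the horizon $T$. Let $\alpha_{\min}=\min_{1\le t\le T}\alpha(\boldsymbol\phi^t)>0$ and $K_1=P(m,1/\alpha_{\min})$. Then, for the congestion function $f(\bar q)=-\sqrt m\,\bar q^{-1/2}$ and any number of supply units $K\ge K_1$, the Mirror Backpressure (MBP) policy satisfies $$L_T^{\mathrm{MBP}}\ \le\ M_1\Big(\frac{K}{T}+\sqrt{\eta K}\Big)+M_2\,\frac1K,\qquad\text{where } M_1=Cm,\quad M_2=Cm^2 .$$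
   Context: **Model (joint entry-assignment).** $V$ is a finite set of nodes, $m=|V|>1$, and $K$ is a positive integer (number of identical supply units). $\mathcal T$ is a finite set of demand types; each $\tau\in\mathcal T$ has nonempty pick-up and drop-off neighborhoods $\mathcal P(\tau),\mathcal D(\tau)\subseteq V$. For $\tau\in\mathcal T$, $j\in\mathcal P(\tau)$, $k\in\mathcal D(\tau)$ there is a payoff $w_{j\tau k}\in\mathbb R$, normalized so that $\max_{\tau,\,j\in\mathcal P(\tau),\,k\in\mathcal D(\tau)}|w_{j\tau k}|=1$. Time is slotted, $t=1,2,\dots$. The state at the start of period $t$ is the vector of queue lengths $\mathbf q[t]\in\Omega_K=\{\mathbf q\in\mathbb Z_{\ge0}^V:\sum_j q_j=K\}$. In period $t$ exactly one demand unit arrives; its type $\tau[t]$ equals $\tau$ with probability $\phi^t_\tau$, independently across periods, where $\boldsymbol\phi^t=(\phi^t_\tau)_{\tau\in\mathcal T}$ is a probability vector. After observing $\tau[t]=\tau$, the controller chooses $x_{j\tau k}[t]\in\{0,1\}$ for $j\in\mathcal P(\tau),k\in\mathcal D(\tau)$ with $\sum_{j,k}x_{j\tau k}[t]\le1$ and $x_{j\tau k}[t]=0$ whenever $q_j[t]=0$ (no-underflow); $x_{j\tau'k}[t]=0$ for $\tau'\ne\tau$. The payoff collected is $v[t]=\sum_{j,k}w_{j\tau k}x_{j\tau k}[t]$ and $\mathbf q[t+1]=\mathbf q[t]+\sum_{j,k}(-\mathbf e_j+\mathbf e_k)x_{j\tau k}[t]$, with $\mathbf e_i$ the unit vectors.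 A feasible policy maps the history of types and states up to time $t$ to a (possibly randomized) decision satisfying these constraints. **Performance.** For a policy $\pi$ with payoffs $v^\pi[t]$, $W_T^\pi=\min_{\mathbf q\in\Omega_K}\frac1T\sum_{t=1}^T\mathbb E[v^\pi[t]\mid\mathbf q[1]=\mathbf q]$; $W_T^*=\sup_{\pi}\max_{\mathbf q\in\Omega_K}\frac1T\sum_{t=1}^T\mathbb E[v^\pi[t]\mid\mathbf q[1]=\mathbf q]$, the supremum being over all feasible policies (which may depend on the arrival rates). $L_T^\pi=W_T^*-W_T^\pi$. **Connectedness.** For a probability vector $\boldsymbol\phi$ on $\mathcal T$, $\alpha(\boldsymbol\phi)=\min_{\emptyset\ne S\subsetneq V}\sum_{\tau:\ \mathcal P(\tau)\cap S\neq\emptyset,\ \mathcal D(\tau)\cap(V\setminus S)\ne\emptyset}\phi_\tau$. **Slowly varying demand.** Rates vary $\eta$-slowly over horizon $T$ if $\frac1{T-1}\sum_{t=1}^{T-1}\|\boldsymbol\phi^{t+1}-\boldsymbol\phi^t\|_1\le\eta$ (vacuous if $T=1$). **MBP policy.** Normalized queue lengths: $\bar q_j=\frac{q_j+\delta_K}{\tilde K}$ with $\delta_K=\sqrt K$, $\tilde K=K+m\sqrt K$. Given an increasing congestion function $f$, when a type-$\tau$ demand arrives in period $t$, MBP lets $(j^*,k^* )$ be a maximizer over $j\in\mathcal P(\tau),k\in\mathcal D(\tau)$ of $w_{j\tau k}+f(\bar q_j[t])-f(\bar q_k[t])$ (ties broken arbitrarily); it sets $x_{j^*\tau k^*}[t]=1$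 (all other $x=0$) if this maximum is $\ge0$ and $q_{j^*}[t]>0$, and otherwise drops the demand (all $x=0$). *)

(* Defs.v *)
From HB Require Import structures.
From mathcomp Require Import all_boot all_order all_algebra.
From mathcomp Require Import all_classical all_reals all_analysis.

Set Implicit Arguments.
Unset Strict Implicit.
Unset Printing Implicit Defensive.

Import Order.TTheory GRing.Theory Num.Theory.
Local Open Scope classical_set_scope.
Local Open Scope ring_scope.

(* [payoff j tau k] is meaningful only for j in [pickup tau] and k in
   [dropoff tau]; nothing below reads its other values.  All terms of the
   \big[Num.max/0] are nonnegative, so it is the plain maximum. *)
Record model (R : realType) := Model {
  node : finType;
  demand : finType;
  pickup : demand -> {set node};
  dropoff : demand -> {set node};
  payoff : node -> demand -> node -> R;
  node_gt1 : (1 < #|node|)%N;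
  pickup_neq0 : forall tau, pickup tau != finset.set0;
  dropoff_neq0 : forall tau, dropoff tau != finset.set0;
  payoff_normalized :
    \big[Num.max/0]_(tau : demand)
      \big[Num.max/0]_(j in pickup tau)
        \big[Num.max/0]_(k in dropoff tau) `|payoff j tau k| = 1
}.

Definition state (R : realType) (G : model R) : Type := {ffun node G -> nat}.

Definition Omega (R : realType) (G : model R) (K : nat) : set (state G) :=
  [set q | (\sum_(j : node G) q j)%N = K].

Arguments Omega {R} G K.

Definition decision (R : realType) (G : model R) : finType :=
  {ffun node G * demand G * node G -> bool}.

Definition feasible (R : realType) (G : model R) (q : state G) (tau : demand G)
    (x : decision G) : bool :=
  [forall j, forall tau', forall k, x (j, tau', k) ==>
     [&& tau' == tau, j \in pickup tau, k \in dropoff tau & (0 < q j)%N]] &&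
  (\sum_(j in pickup tau) \sum_(k in dropoff tau) x (j, tau, k) <= 1)%N.

Definition collected (R : realType) (G : model R) (tau : demand G)
    (x : decision G) : R :=
  \sum_(j in pickup tau) \sum_(k in dropoff tau)
     payoff j tau k * (x (j, tau, k))%:R.

(* The truncated subtraction is exact for feasible x: node i sends a unit only
   if 0 < q i. *)
Definition step (R : realType) (G : model R) (q : state G) (tau : demand G)
    (x : decision G) : state G :=
  [ffun i =>
     (q i + \sum_(j in pickup tau) \sum_(k in dropoff tau)
              (k == i) * x (j, tau, k)
          - \sum_(j in pickup tau) \sum_(k in dropoff tau)
              (j == i) * x (j, tau, k))%N].

(* The (state, type) pairs of the past periods, oldest first; its size
   determines the current period. *)
Definition history (R : realType) (G : model R) : Type :=
  seq (state G * demand G).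

(* [decide h q tau x] is the probability of decision x after history h, in
   state q, when the arriving type is tau. *)
Record policy (R : realType) (G : model R) := Policy {
  decide : history G -> state G -> demand G -> decision G -> R;
  decide_ge0 : forall h q tau x, 0 <= decide h q tau x;
  decide_sum1 : forall h q tau, \sum_(x : decision G) decide h q tau x = 1;
  decide_feasible : forall h q tau x,
    0 < decide h q tau x -> feasible q tau x
}.

Definition prob_vector (R : realType) (D : finType) (phi : D -> R) : Prop :=
  (forall tau, 0 <= phi tau) /\ \sum_(tau : D) phi tau = 1.

(* Probability that, from period t on, with past history h and state q at the
   start of period t, the arriving types and the decisions are those listed
   in s.  Periods are numbered from 1, and [phi t] is the law of the type
   arriving in period t. *)
Fixpoint path_prob (R : realType) (G : model R) (phi : nat -> demand G -> R)
    (pi : policy G) (t : nat) (h : history G) (q : state G)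
    (s : seq (demand G * decision G)) : R :=
  if s is (tau, x) :: s' then
    phi t tau * decide pi h q tau x *
    path_prob phi pi t.+1 (rcons h (q, tau)) (step q tau x) s'
  else 1.

(* Expected payoff of period t.+1, given that the initial state is q. *)
Definition expected_payoff (R : realType) (G : model R)
    (phi : nat -> demand G -> R) (pi : policy G) (T : nat) (q : state G)
    (t : 'I_T) : R :=
  \sum_(s : T.-tuple (demand G * decision G))
     path_prob phi pi 1 [::] q s * collected (tnth s t).1 (tnth s t).2.

Definition average_payoff (R : realType) (G : model R)
    (phi : nat -> demand G -> R) (T : nat) (pi : policy G) (q : state G) : R :=
  T%:R^-1 * \sum_(t < T) expected_payoff phi pi q t.

(* Below, [inf] and [sup] over [Omega], over a range of periods and over node
   subsets are a minimum and a maximum, the index sets being finite and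
   nonempty. *)

Definition W_policy (R : realType) (G : model R) (K : nat)
    (phi : nat -> demand G -> R) (T : nat) (pi : policy G) : R :=
  inf [set average_payoff phi T pi q | q in Omega G K].

Definition W_star (R : realType) (G : model R) (K : nat)
    (phi : nat -> demand G -> R) (T : nat) : R :=
  sup [set sup [set average_payoff phi T pi q | q in Omega G K]
      | pi in [set: policy G]].

Definition loss (R : realType) (G : model R) (K : nat)
    (phi : nat -> demand G -> R) (T : nat) (pi : policy G) : R :=
  W_star K phi T - W_policy K phi T pi.

Definition connectedness (R : realType) (G : model R) (phi : demand G -> R) : R :=
  inf [set \sum_(tau | (pickup tau :&: S != finset.set0) &&
                       (dropoff tau :&: ~: S != finset.set0)) phi tau
      | S in [set S : {set node G} |
                S != finset.set0 /\ S != [set: node G]%SET]].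

Definition alpha_min (R : realType) (G : model R) (phi : nat -> demand G -> R)
    (T : nat) : R :=
  inf [set connectedness (phi t) | t in [set t | (1 <= t <= T)%N]].

Definition slowly_varying (R : realType) (D : finType) (phi : nat -> D -> R)
    (T : nat) (eta : R) : Prop :=
  (1 < T)%N ->
  (T.-1)%:R^-1 *
    \sum_(1 <= t < T) \sum_(tau : D) `|phi t.+1 tau - phi t tau| <= eta.

Definition qbar (R : realType) (G : model R) (K : nat) (q : state G)
    (j : node G) : R :=
  ((q j)%:R + Num.sqrt K%:R) / (K%:R + #|node G|%:R * Num.sqrt K%:R).

Definition score (R : realType) (G : model R) (K : nat) (f : R -> R)
    (q : state G) (tau : demand G) (j k : node G) : R :=
  payoff j tau k + f (qbar K q j) - f (qbar K q k).

Definition score_maximizer (R : realType) (G : model R) (K : nat) (f : R -> R)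
    (q : state G) (tau : demand G) (j k : node G) : Prop :=
  [/\ j \in pickup tau, k \in dropoff tau &
      forall j' k', j' \in pickup tau -> k' \in dropoff tau ->
        score K f q tau j' k' <= score K f q tau j k].

Definition mbp_decision (R : realType) (G : model R) (K : nat) (f : R -> R)
    (q : state G) (tau : demand G) (j k : node G) : decision G :=
  [ffun y => [&& y == (j, tau, k), 0 <= score K f q tau j k & (0 < q j)%N]].

(* Arbitrary tie-breaking: the maximizer may depend on the history and may be
   drawn at random. *)
Definition is_MBP (R : realType) (G : model R) (K : nat) (f : R -> R)
    (pi : policy G) : Prop :=
  forall h q tau x, Omega G K q -> 0 < decide pi h q tau x ->
    exists j k, score_maximizer K f q tau j k /\
                x = mbp_decision K f q tau j k.

Definition inv_sqrt_congestion (R : realType) (m : nat) (y : R) : R :=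
  - Num.sqrt m%:R * (y `^ (- 2^-1)).

(* Main.v *)
(* Write g_phi(y) = sum_tau phi_tau max(0, max_(j,k) w_(j tau k) + y_j - y_k)
   for the dual of the fluid problem with node prices y.
   - A payoff v of any policy satisfies E v <= g(y) + y . E[Delta q] for every y.
     Freezing y at a near-minimizer of g over blocks of length about
     sqrt(K / eta), the last term telescopes up to 2mK per block and the drift
     of phi costs O(m) times the variation of phi within the block.
   - For the prices y = f(qbar), MBP attains g(y) + y . Delta q except at empty
     queues, and y . Delta q is the increment of the convex potential with
     gradient f, up to a second-order error O(sqrt m (min qbar)^(-3/2) / K).
   - Shrinking to 2 every larger gap between consecutive values of y lowers g at
     rate at least alpha, so g(y) exceeds its minimum by alpha (spread y - 2m).
     For K large this excess pays for the error and the idling whenever some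
     queue is short; otherwise the error is O(m^2 / K). *)
Require Import Defs.
From HB Require Import structures.
From mathcomp Require Import all_boot all_order all_algebra.
From mathcomp Require Import all_classical all_reals all_analysis.
From mathcomp Require Import ring lra zify.

Set Implicit Arguments.
Unset Strict Implicit.
Unset Printing Implicit Defensive.

Import Order.TTheory GRing.Theory Num.Theory.
Local Open Scope ring_scope.

(** * Dual prices *)

Lemma exists_argmin (R : realType) (I : finType) (a : I) (F : I -> R) :
  exists i, forall j, F i <= F j.
Proof.
exists [arg min_(i < a) F i]%O.
by case: Order.TotalTheory.arg_minP => // i _ h j; exact: h.
Qed.

Section Dual.
Variables (R : realType) (G : model R).
Implicit Types (y : node G -> R) (p : demand G -> R) (S : {set node G}).

(** The start value 0 of the maxima is the option of dropping the demand, so that [fluid_dual p]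
    below is the dual function g. *)
Definition best y (tau : demand G) : R :=
  \big[Num.max/0]_(j in pickup tau) \big[Num.max/0]_(k in dropoff tau)
    (payoff j tau k + y j - y k).

Definition fluid_dual p y : R := \sum_(tau : demand G) p tau * best y tau.

Definition cut_rate p S : R :=
  \sum_(tau | (pickup tau :&: S != finset.set0) &&
              (dropoff tau :&: ~: S != finset.set0)) p tau.

Lemma payoff_bound (j : node G) tau (k : node G) :
  j \in pickup tau -> k \in dropoff tau -> `|payoff j tau k| <= 1.
Proof.
move=> jP kD; rewrite -(payoff_normalized G).
apply: le_trans (le_bigmax _ _ tau).
apply: le_trans (le_bigmax_cond _ _ jP).
exact: le_trans (le_bigmax_cond _ _ kD).
Qed.

Lemma best_ge y tau j k : j \in pickup tau -> k \in dropoff tau ->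
  payoff j tau k + y j - y k <= best y tau.
Proof.
move=> jP kD; apply: le_trans (le_bigmax_cond _ _ jP).
exact: le_trans (le_bigmax_cond _ _ kD).
Qed.

Lemma best_ge0 y tau : 0 <= best y tau.
Proof. exact: bigmax_ge_id. Qed.

Lemma best_le y tau b : 0 <= b ->
  (forall j k, j \in pickup tau -> k \in dropoff tau ->
     payoff j tau k + y j - y k <= b) ->
  best y tau <= b.
Proof. by move=> b0 h; do 2![apply/bigmax_leP; split=> // ? ?]; exact: h. Qed.

Lemma best_spread y d tau : 0 <= d -> (forall i j, y i - y j <= d) ->
  best y tau <= 1 + d.
Proof.
move=> d0 hy; apply: best_le => [|j k jP kD]; first lra.
by have := payoff_bound jP kD; have := hy j k; rewrite ler_norml => ? /andP[]; lra.
Qed.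

(** The dual is linear in the rates, with coefficients [best y tau] in [0, 1 + d]. This prices the
    variation of the rates. *)
Lemma dual_lipschitz p p' y d : 0 <= d -> (forall i j, y i - y j <= d) ->
  fluid_dual p y <= fluid_dual p' y + (1 + d) * \sum_tau `|p tau - p' tau|.
Proof.
move=> d0 hy; rewrite mulr_sumr -big_split; apply: ler_sum => tau _ /=.
have b0 := best_ge0 y tau; have bd := best_spread tau d0 hy.
rewrite -lerBlDl -mulrBl.
apply: (le_trans (ler_wpM2r b0 (ler_norm _))).
by rewrite mulrC ler_wpM2r.
Qed.

Lemma connectedness_le p S : prob_vector p ->
  S != finset.set0 -> S != [set: node G]%SET -> connectedness p <= cut_rate p S.
Proof.
move=> [p0 _] S0 ST; apply: ge_inf; last by exists S.
by exists 0 => _ [S' _ <-]; apply: sumr_ge0.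
Qed.

(* When the gap across the cut is at least 2 + c, the best move of a type
   crossing the cut crosses it, both before and after the gap shrinks by c. *)
Lemma best_shrink_gap y S c tau : 0 <= c ->
  (forall i k, i \in S -> k \notin S -> y k + 2 + c <= y i) ->
  best (fun i => y i + c * (i \notin S)%:R) tau +
    c * ((pickup tau :&: S != finset.set0) &&
         (dropoff tau :&: ~: S != finset.set0))%:R <= best y tau.
Proof.
move=> c0 gap; rewrite -lerBrDr.
case: (boolP (_ && _)) => [/andP[/set0Pn[a] + /set0Pn[b]]|ncross].
  rewrite !inE => /andP[aP aS] /andP[bD bS]; rewrite mulr1.
  have ab : 1 + c <= best y tau.
    have := best_ge y aP bD; have := gap _ _ aS bS; have := payoff_bound aP bD.
    rewrite ler_norml => /andP[]; lra.
  apply: best_le => [|j k jP kD]; first lra.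
  have := payoff_bound jP kD; have := best_ge y jP kD.
  (* A move inside [S] is beaten by redirecting its target to [b], a move outside [S] by starting it
     at [a] instead. A move into [S] is worth at most -1 after the shrinking, and a move out of [S]
     loses exactly [c]. *)
  case: (boolP (j \in S)) => jS; case: (boolP (k \in S)) => kS /=.
  - have := best_ge y jP bD; have := gap _ _ kS bS; have := payoff_bound jP bD.
    rewrite !ler_norml => /andP[? ?] ? ? ? /andP[]; lra.
  - lra.
  - have := gap _ _ kS jS; rewrite !ler_norml => ? ? /andP[]; lra.
  - have := best_ge y aP kD; have := gap _ _ aS jS; have := payoff_bound aP kD.
    rewrite !ler_norml => /andP[? ?] ? ? ? /andP[]; lra.
rewrite mulr0 subr0; apply: best_le => [|j k jP kD]; first exact: best_ge0.
have := payoff_bound jP kD; have := best_ge y jP kD; have := best_ge0 y tau.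
case: (boolP (j \in S)) => jS; case: (boolP (k \in S)) => kS /=.
- lra.
- move: ncross; rewrite negb_and !negbK => /orP[] /eqP/setP.
    by move/(_ j); rewrite !inE jP jS.
  by move/(_ k); rewrite !inE kD kS.
- have := gap _ _ kS jS; rewrite !ler_norml => ? ? ? /andP[]; lra.
- lra.
Qed.

Lemma dual_shrink_gap p y S c : (forall tau, 0 <= p tau) -> 0 <= c ->
  (forall i k, i \in S -> k \notin S -> y k + 2 + c <= y i) ->
  fluid_dual p (fun i => y i + c * (i \notin S)%:R) + c * cut_rate p S <= fluid_dual p y.
Proof.
move=> p0 c0 gap; rewrite /cut_rate [X in c * X]big_mkcond mulr_sumr -big_split.
apply: ler_sum => tau _ /=.
apply: le_trans (ler_wpM2l (p0 tau) (best_shrink_gap tau c0 gap)).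
by rewrite mulrDr lerD2l; case: (_ && _); rewrite ?mulr1 ?mulr0 // mulrC.
Qed.

(* Top-down pass over the sorted prices: the k+1 highest ones already lie
   within 2k of the maximum. *)
Lemma compress_prices_step y (i0 i1 : node G) (k : nat) :
  (forall i, y i <= y i0) -> (forall i, y i1 <= y i) ->
  exists y', [/\ forall i, y i <= y' i, forall i, y' i <= y i0, forall i, y' i1 <= y' i,
    (minn k.+1 #|node G| <= #|[set i | (y i0 - 2 * k%:R <= y' i)%R]%SET|)%N &
    forall p, prob_vector p ->
      fluid_dual p y' + connectedness p * (y' i1 - y i1) <= fluid_dual p y].
Proof.
move=> hi0 hi1; elim: k => [|k [y' [up top bot card drop]]].
  exists y; split=> //; last by move=> p _; rewrite subrr mulr0 addr0.
  apply: (leq_trans (geq_minl _ _)); apply/card_gt0P; exists i0.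
  by rewrite inE mulr0 subr0.
set S := [set i | _]%SET in card.
have [ST|ST] := eqVneq S [set: node G]%SET.
  exists y'; split=> //; apply: (leq_trans (geq_minr _ _)).
  apply: subset_leq_card; apply/fintype.subsetP => i _.
  have : i \in S by rewrite ST inE.
  rewrite !inE => h; apply: le_trans h; rewrite -[k.+1%:R]natr1; lra.
have [S0|S0] := eqVneq S finset.set0.
  by move: card; rewrite S0 cards0 leqNgt leq_min /= (ltnW (node_gt1 G)).
have /set0Pn[a1] : ~: S != finset.set0.
  by apply: contra ST => /eqP h; rewrite -(finset.setCK S) h finset.setC0.
rewrite finset.in_setC => a1S.
have [a aS amax] : exists2 a, a \notin S & forall i, i \notin S -> y' i <= y' a.
  exists [arg max_(i > a1 | i \notin S) y' i]%O;
     case: Order.TotalTheory.arg_maxP => // i _ h j; exact: h.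
set v := y i0 - 2 * k.+1%:R.
have vE : v = y i0 - 2 * k%:R - 2 by rewrite /v -[k.+1%:R]natr1; lra.
have sub_card (z : node G -> R) : (forall i, i \in S -> y i0 - 2 * k%:R <= z i) ->
    v <= z a -> (minn k.+2 #|node G| <= #|[set i | (v <= z i)%R]%SET|)%N.
  move=> zS za; apply: (leq_trans (geq_minl _ _)).
  have : (k < #|S|)%N.
    have : (#|S| < #|[set: node G]%SET|)%N.
      by apply: proper_card; rewrite finset.properEneq ST finset.subsetT.
    by rewrite cardsT; lia.
  move=> hk; apply: leq_trans (subset_leq_card (_ : a |: S \subset _)%SET).
    by rewrite cardsU1 aS.
  apply/fintype.subsetP => i; rewrite in_setU1 inE.
  case/orP=> [/eqP-> //|/zS h]; apply: le_trans h; rewrite vE; lra.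
have [va|va] := leP v (y' a).
  exists y'; split=> //; apply: sub_card => // i.
  by rewrite /S inE.
(* Raising every price outside [S] by [c] lifts [a] exactly to the new threshold [v]. The threshold
   of [S] is [v + 2], so the gap is at least 2 + c beforehand. The lowest node [i1] is always
   raised, hence its total rise records the total shrinking. *)
pose c := v - y' a.
have c0 : 0 <= c by rewrite subr_ge0 ltW.
have gap i j : i \in S -> j \notin S -> y' j + 2 + c <= y' i.
  move=> iS jS; have := amax _ jS; move: iS; rewrite inE /c; lra.
have i1S : i1 \notin S.
  apply: contra aS; rewrite !inE => h; exact: le_trans h (bot a).
exists (fun i => y' i + c * (i \notin S)%:R); split.
- by move=> i; apply: le_trans (up i) _; rewrite lerDl mulr_ge0.
- move=> i; case: (boolP (i \in S)) => iS /=; first by rewrite mulr0 addr0.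
  by have := amax _ iS; rewrite /c mulr1 vE; have := ler0n R k; lra.
- move=> i; rewrite i1S mulr1; case: (boolP (i \in S)) => iS /=.
    by have := gap _ _ iS i1S; lra.
  by rewrite mulr1 lerD2r.
- apply: sub_card; last by rewrite aS mulr1 /c; lra.
  by move=> i iS; rewrite iS mulr0 addr0; move: iS; rewrite inE.
- move=> p pp; rewrite i1S mulr1; apply: le_trans (drop _ pp).
  have := dual_shrink_gap (proj1 pp) c0 gap.
  have := ler_wpM2l c0 (connectedness_le pp S0 ST).
  rewrite -/S; lra.
Qed.

(** One pass per node brings all prices within 2m of the top, so the lowest price rises by at least
    the spread minus 2m. The choice of [y'] precedes [p]: the same compressed prices serve all rate
    vectors, hence all periods. *)
Lemma compress_prices y : exists y',
  (forall i j, y' i - y' j <= 2 * #|node G|%:R) /\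
  forall p, prob_vector p -> 0 <= connectedness p -> forall i j,
    fluid_dual p y' +
      connectedness p * Num.max 0 (y i - y j - 2 * #|node G|%:R) <= fluid_dual p y.
Proof.
have /card_gt0P[a _] : (0 < #|node G|)%N := ltnW (node_gt1 G).
have [i0 hi0] : exists i0, forall i, y i <= y i0.
  by have [i hi] := exists_argmin a (fun i => - y i); exists i => j; rewrite -lerN2.
have [i1 hi1] := exists_argmin a y.
have [y' [up top bot card drop]] := compress_prices_step #|node G| hi0 hi1.
have low i : y i0 - 2 * #|node G|%:R <= y' i.
  suff /setP/(_ i) : [set i | (y i0 - 2 * #|node G|%:R <= y' i)%R]%SET = [set: node G]%SET.
    by rewrite !inE.
  apply/eqP; rewrite eqEcard finset.subsetT cardsT; apply: leq_trans card.
  by rewrite leq_min leqnSn leqnn.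
exists y'; split=> [i j|p pp cp i j].
  by have := top i; have := low j; lra.
apply: le_trans (drop _ pp); rewrite lerD2l ler_wpM2l // ge_max.
have := top i1; have := hi0 i; have := hi1 j; have := low i1.
by have := up i1; move=> *; apply/andP; split; lra.
Qed.
End Dual.

(** * Decisions *)

Lemma big_pair1 (T : Type) (idx : T) (op : Monoid.com_law idx) (I : finType)
    (A B : {set I}) (F : I -> I -> T) (j k : I) : j \in A -> k \in B ->
  (forall j' k', (j', k') != (j, k) -> F j' k' = idx) ->
  \big[op/idx]_(j' in A) \big[op/idx]_(k' in B) F j' k' = F j k.
Proof.
move=> jA kB F0; rewrite (bigD1 j) //= (bigD1 k) //=.
rewrite big1 => [|k' /andP[_ kk]]; last first.
  by apply: F0; rewrite xpair_eqE negb_and kk orbT.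
rewrite big1 ?Monoid.mulm1 // => j' /andP[_ jj].
by apply: big1 => k' _; apply: F0; rewrite xpair_eqE negb_and jj.
Qed.

Section Decisions.
Variables (R : realType) (G : model R).
Implicit Types (q : state G) (tau : demand G) (j k : node G).

(** The flag [b] tells serving from dropping, so that this single form covers every feasible
    decision; for [b = false] the nodes are irrelevant. *)
Definition unit_decision j tau k (b : bool) : decision G :=
  [ffun y => (y == (j, tau, k)) && b].

Lemma mbp_decisionE K f q tau j k :
  mbp_decision K f q tau j k =
  unit_decision j tau k ((0 <= score K f q tau j k) && (0 < q j)%N).
Proof. by []. Qed.

Lemma feasible_unit q tau x : feasible q tau x ->
  exists j k b, [/\ j \in pickup tau, k \in dropoff tau, b ==> (0 < q j)%N &
                    x = unit_decision j tau k b].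
Proof.
case/andP=> /forallP xP x1.
have xE j t k : x (j, t, k) ->
    [&& t == tau, j \in pickup tau, k \in dropoff tau & (0 < q j)%N].
  by have /forallP/(_ t)/forallP/(_ k)/implyP := xP j.
case: (pickP (fun y => x y)) => [[[j t] k] xjk|x0]; last first.
  have /set0Pn[j jP] := pickup_neq0 tau; have /set0Pn[k kD] := dropoff_neq0 tau.
  exists j, k, false; split=> //; apply/ffunP => y.
  by rewrite ffunE andbF; exact: x0.
have /and4P[/eqP tE jP kD qj] := xE _ _ _ xjk; rewrite {t}tE in xjk.
exists j, k, true; split=> //; apply/ffunP => -[[j' t] k']; rewrite ffunE andbT.
case: eqP => [-> //|ne]; apply/negbTE/negP => xjk'.
have /and4P[/eqP tE jP' kD' _] := xE _ _ _ xjk'; rewrite {t}tE in xjk' ne.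
move: x1; rewrite pair_big /= (bigD1 (j, k)) /= ?jP // (bigD1 (j', k')) /=.
  by rewrite xjk xjk'.
by rewrite jP' kD'; apply: contra_notN ne => /eqP[-> ->].
Qed.

Lemma collected_unit tau j k b : j \in pickup tau -> k \in dropoff tau ->
  collected tau (unit_decision j tau k b) = payoff j tau k * b%:R.
Proof.
move=> jP kD; rewrite /collected (big_pair1 _ jP kD) /= => [|j' k' ne].
  by rewrite ffunE eqxx.
rewrite ffunE !xpair_eqE eqxx andbT -xpair_eqE (negPf ne).
by rewrite mulr0.
Qed.

Lemma step_unit q tau j k b i : j \in pickup tau -> k \in dropoff tau ->
  step q tau (unit_decision j tau k b) i =
  (q i + (k == i) * b - (j == i) * b)%N.
Proof.
move=> jP kD; rewrite ffunE !(big_pair1 _ jP kD) /= => [|j' k' ne|j' k' ne];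
  first by rewrite !ffunE eqxx.
all: by rewrite ffunE !xpair_eqE eqxx andbT -xpair_eqE (negPf ne) muln0.
Qed.

Lemma step_unit_natr q tau j k (b : bool) i :
  j \in pickup tau -> k \in dropoff tau -> b ==> (0 < q j)%N ->
  (step q tau (unit_decision j tau k b) i)%:R =
  (q i)%:R + (i == k)%:R * b%:R - (i == j)%:R * b%:R :> R.
Proof.
move=> jP kD /implyP bq; rewrite step_unit // natrB ?natrD ?natrM.
  by rewrite ![_ == i]eq_sym.
by case: eqP => // <-; move: bq; case: b => // /(_ isT); lia.
Qed.

Lemma sum_pred1_mul (w : node G -> R) j c : \sum_i w i * ((i == j)%:R * c) = w j * c.
Proof.
rewrite (bigD1 j) //= eqxx mul1r big1 ?addr0 // => i /negPf->.
by rewrite mul0r mulr0.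
Qed.

Lemma sum_step_unit (w : node G -> R) q tau j k (b : bool) :
  j \in pickup tau -> k \in dropoff tau -> b ==> (0 < q j)%N ->
  \sum_i w i * (step q tau (unit_decision j tau k b) i)%:R =
  \sum_i w i * (q i)%:R + (w k - w j) * b%:R.
Proof.
move=> jP kD bq; under eq_bigr do rewrite step_unit_natr // !mulrDr mulrN.
by rewrite sumrB big_split /= !sum_pred1_mul; ring.
Qed.

Lemma feasible_Omega K q tau x : feasible q tau x -> Omega G K q ->
  Omega G K (step q tau x).
Proof.
move=> /feasible_unit[j [k [b [jP kD bq ->]]]] <-.
(* Pairing the queues with the constant price 1 gives conservation of supply. *)
have := @sum_step_unit (fun=> 1) q tau j k b jP kD bq.
rewrite -!mulr_sumr !mul1r subrr mul0r addr0 -!natr_sum => /eqP.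
by rewrite eqr_nat => /eqP.
Qed.

(** Weak duality for one period: serving from j to k moves the pairing of [y] with the queues by
    [y k - y j], and dropping earns 0. *)
Lemma collected_le_best y q tau x : feasible q tau x ->
  collected tau x <=
  best y tau + (\sum_i y i * (step q tau x i)%:R - \sum_i y i * (q i)%:R).
Proof.
move=> /feasible_unit[j [k [b [jP kD bq ->]]]].
rewrite collected_unit // sum_step_unit //.
case: b {bq}; rewrite ?mulr1 ?mulr0.
  by have := best_ge y jP kD; lra.
by have := best_ge0 y tau; lra.
Qed.
End Decisions.

(** * Expected payoffs along a policy *)

Lemma sum_tuple_cons (V : nmodType) (A B : finType) n
    (F : n.+1.-tuple (A * B) -> V) :
  \sum_(s : n.+1.-tuple (A * B)) F s =
  \sum_(a : A) \sum_(b : B) \sum_(s : n.-tuple (A * B)) F [tuple of (a, b) :: s].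
Proof.
rewrite (reindex (fun p : (A * B) * n.-tuple (A * B) => [tuple of p.1 :: p.2])) /=.
  rewrite -(pair_bigA _ (fun p (s : n.-tuple _) => F [tuple of p :: s])) /=.
  rewrite (pair_bigA _ (fun a b => \sum_(s : n.-tuple _) F [tuple of (a, b) :: s])) /=.
  by apply: eq_bigr => -[].
exists (fun s => (thead s, [tuple of behead s])) => [[a s] _|s _] /=.
  by congr pair; apply: val_inj.
by rewrite [s in RHS]tuple_eta.
Qed.

Section Value.
Variables (R : realType) (G : model R) (phi : nat -> demand G -> R).
Variables (pi : policy G) (T K : nat).
Hypothesis phi_prob : forall t, (1 <= t <= T)%N -> prob_vector (phi t).
Implicit Types (q : state G) (h : history G) (t n : nat).
Implicit Types r : demand G -> decision G -> R.

(** The reward [r] is left free: payoffs are bounded above with [collected], and below with its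
    negation. *)
Definition value r n t h q : R :=
  \sum_(s : n.-tuple (demand G * decision G))
    path_prob phi pi t h q s * \sum_(i < n) r (tnth s i).1 (tnth s i).2.

Lemma sum_expected_payoff q :
  \sum_(t < T) expected_payoff phi pi q t =
  value (@collected R G) T 1 [::] q.
Proof.
rewrite /expected_payoff exchange_big /=.
by apply: eq_bigr => s _; rewrite mulr_sumr.
Qed.

Lemma value_opp r n t h q : value (fun tau x => - r tau x) n t h q = - value r n t h q.
Proof.
rewrite /value -sumrN; apply: eq_bigr => s _.
by rewrite sumrN mulrN.
Qed.

Lemma sum_path_prob n t h q : (0 < t)%N -> (t + n <= T.+1)%N ->
  \sum_(s : n.-tuple (demand G * decision G)) path_prob phi pi t h q s = 1.
Proof.
elim: n t h q => [|n IH] t h q t0 tn.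
  rewrite (big_pred1 [tuple]) //= => s; apply/esym/eqP; exact: tuple0.
rewrite sum_tuple_cons /=.
have [|_ <-] := phi_prob (t := t); first by lia.
apply: eq_bigr => tau _; rewrite -[RHS]mulr1 -(decide_sum1 pi h q tau) mulr_sumr.
apply: eq_bigr => x _; rewrite -mulr_sumr IH ?mulr1 //; lia.
Qed.

Lemma valueS r n t h q : (0 < t)%N -> (t + n <= T)%N ->
  value r n.+1 t h q = \sum_tau phi t tau * \sum_x decide pi h q tau x *
    (r tau x + value r n t.+1 (rcons h (q, tau)) (step q tau x)).
Proof.
move=> t0 tn; rewrite /value sum_tuple_cons.
apply: eq_bigr => tau _; rewrite [RHS]mulr_sumr; apply: eq_bigr => x _.
rewrite -[X in X + _]mul1r -(@sum_path_prob n t.+1 (rcons h (q, tau)) (step q tau x)) //.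
rewrite mulr_suml -big_split mulrA [RHS]mulr_sumr; apply: eq_bigr => s _ /=.
rewrite big_ord_recl !tnth0 /= -mulrDr mulrA; congr (_ * (_ + _)).
by apply: eq_bigr => i _; rewrite tnthS.
Qed.

(** Backward induction with a potential [Phi]: the drift condition makes the remaining costs plus
    [Phi] a supersolution of the dynamic program. The bound [b] is tested for each possible decision
    but averaged only over types, since the decision is made after the type is seen. *)
Lemma value_le r (c : nat -> R) (Phi : nat -> state G -> R) :
  (forall t h q, (1 <= t <= T)%N -> Omega G K q ->
     exists2 b : demand G -> R, \sum_tau phi t tau * b tau <= c t &
       forall tau x, 0 < decide pi h q tau x ->
         r tau x + Phi t.+1 (step q tau x) <= b tau + Phi t q) ->
  (forall q, Omega G K q -> 0 <= Phi T.+1 q) ->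
  forall n t h q, (0 < t)%N -> (t + n = T.+1)%N -> Omega G K q ->
    value r n t h q <= \sum_(t <= s < T.+1) c s + Phi t q.
Proof.
move=> Hstep Hend; elim=> [|n IH] t h q t0 tn Kq.
  rewrite /value big_geq; last by lia.
  rewrite add0r big1 => [|s _]; last by rewrite big_ord0 mulr0.
  have -> : t = T.+1 by lia.
  exact: Hend.
have tT : (1 <= t <= T)%N by lia.
have [p0 p1] := phi_prob tT.
rewrite valueS //; last by lia.
rewrite big_ltn; last by lia.
have [b bc hb] := Hstep t h q tT Kq.
set C := \sum_(t.+1 <= s < T.+1) c s.
suff : \sum_tau phi t tau * \sum_x decide pi h q tau x *
    (r tau x + value r n t.+1 (rcons h (q, tau)) (step q tau x)) <=
    \sum_tau phi t tau * (b tau + (Phi t q + C)).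
  move/le_trans; apply; under eq_bigr do rewrite mulrDr.
  by rewrite big_split /= -mulr_suml p1 mul1r; lra.
apply: ler_sum => tau _; apply: ler_wpM2l => //.
rewrite -[leRHS]mul1r -(decide_sum1 pi h q tau) mulr_suml.
apply: ler_sum => x _; have := decide_ge0 pi h q tau x.
rewrite le_eqVlt => /orP[/eqP<-|d0]; first by rewrite !mul0r.
rewrite ler_wpM2l ?(ltW d0) //.
have Kq' := feasible_Omega (decide_feasible d0) Kq.
have := IH t.+1 (rcons h (q, tau)) _ isT _ Kq'.
have := hb _ _ d0; rewrite -/C => ? /(_ ltac:(lia)); lra.
Qed.
End Value.

(** * The potential along MBP *)

(** The factors [true] keep the shape that [step_unit] gives to the new queue when a demand is
    served. *)
Lemma unit_move_neq (a : nat) (b c : bool) :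
  ((a != (a + c * true - b * true)%N) <= b + c)%N.
Proof. by case: b; case: c; case: eqP => //=; lia. Qed.

Lemma unit_move_adjacent (a : nat) (b c : bool) (a' := (a + c * true - b * true)%N) :
  b ==> (0 < a)%N -> [|| a' == a, a' == a.+1 | a == a'.+1].
Proof. by rewrite /a' {a'}; case: b; case: c => /=; lia. Qed.

(** * Numerical thresholds on the supply K *)

Section Estimates.
Variables (R : realType) (m K delta A r alpha : R).
Hypotheses (m_gt0 : 0 < m) (K_gt0 : 0 < K) (delta_gt0 : 0 < delta).
Hypotheses (A_gt0 : 0 < A) (r_gt0 : 0 < r) (alpha_gt0 : 0 < alpha).
Hypotheses (delta_sqr : delta ^+ 2 = K) (A_sqr_ge : m * K <= A ^+ 2).

(** In the application [r ^+ 2] is the shortest queue plus [delta], and [- A / r] is the lowest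
    price; here that queue is empty. If [A <= 6 * m * r], then [delta <= 36 * m], so K is at most
    1296 m^2. *)
Lemma large_price_at_empty : r ^+ 2 = delta -> 1297 * m ^+ 2 <= K ->
  6 * m * r < A.
Proof.
move=> rE hK; rewrite ltNge; apply/negP => small.
have h : A ^+ 2 <= (6 * m * r) ^+ 2.
  by rewrite ler_pXn2r ?nnegrE ?(ltW A_gt0) // (le_trans (ltW A_gt0)).
have dm : delta <= 36 * m.
  rewrite -(ler_pM2l delta_gt0) -(ler_pM2l m_gt0) -expr2 delta_sqr.
  apply: (le_trans A_sqr_ge); apply: (le_trans h).
  by rewrite !exprMn rE; lra.
have : delta ^+ 2 <= (36 * m) ^+ 2.
  by rewrite ler_pXn2r ?nnegrE ?mulr_ge0 ?(ltW delta_gt0) ?(ltW m_gt0).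
have := exprn_gt0 2 m_gt0.
rewrite delta_sqr exprMn; lra.
Qed.

(** Cube the hypothesis and use [m * K <= A ^+ 2]; the constant is 432 = 2 * 6^3. *)
Lemma small_price_error : A <= 6 * m * r -> 2 * (A / r ^+ 3) <= 432 * m ^+ 2 / K.
Proof.
move=> small.
have cube : A ^+ 3 <= (6 * m * r) ^+ 3.
  by rewrite ler_pXn2r ?nnegrE ?(ltW A_gt0) // (le_trans (ltW A_gt0)).
have AK : A * K <= 216 * m ^+ 2 * r ^+ 3.
  rewrite -(ler_pM2l m_gt0); apply: le_trans (_ : A ^+ 3 <= _).
    by rewrite exprS mulrCA ler_pM2l.
  by apply: (le_trans cube); rewrite !exprMn; lra.
rewrite ler_pdivlMr //.
have -> : 2 * (A / r ^+ 3) * K = 2 * (A * K) / r ^+ 3 by ring.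
by rewrite ler_pdivrMr ?exprn_gt0 //; lra.
Qed.

(** Reduces to [8 <= alpha * r ^+ 2]: half of the dual excess pays for the second-order error. *)
Lemma large_price_error : delta <= r ^+ 2 -> 64 <= alpha ^+ 2 * K ->
  2 * (A / r ^+ 3) <= alpha * (A / r / 2) / 2.
Proof.
move=> dr aK.
have ad : 8 <= alpha * delta.
  rewrite -(@ler_pXn2r _ 2) ?nnegrE ?mulr_ge0 ?(ltW alpha_gt0) ?(ltW delta_gt0) //.
  by rewrite exprMn delta_sqr; apply: le_trans aK; lra.
have ar : 8 <= alpha * r ^+ 2.
  by apply: (le_trans ad); rewrite ler_pM2l.
rewrite -subr_ge0.
have -> : alpha * (A / r / 2) / 2 - 2 * (A / r ^+ 3) =
          A * (alpha * r ^+ 2 - 8) / (4 * r ^+ 3).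
  by field; rewrite lt0r_neq0.
apply: divr_ge0; apply: mulr_ge0; rewrite ?subr_ge0 ?exprn_ge0 //; exact: ltW.
Qed.

(** Reduces to [16 <= alpha ^+ 2 * delta]: the other half of the excess pays for idling at an empty
    queue, which costs at most 1. *)
Lemma large_price_gain : r ^+ 2 = delta -> K <= A ^+ 2 -> 256 <= alpha ^+ 4 * K ->
  1 <= alpha * (A / r / 2) / 2.
Proof.
move=> rE AK aK.
have -> : alpha * (A / r / 2) / 2 = alpha * A / (4 * r).
  by field; rewrite lt0r_neq0.
rewrite ler_pdivlMr ?mulr_gt0 // mul1r.
rewrite -(@ler_pXn2r _ 2) ?nnegrE ?mulr_ge0 ?(ltW A_gt0) ?(ltW r_gt0)
  ?(ltW alpha_gt0) // !exprMn rE.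
have a2d : 16 <= alpha ^+ 2 * delta.
  rewrite -(@ler_pXn2r _ 2) ?nnegrE ?mulr_ge0 ?exprn_ge0 ?(ltW alpha_gt0)
    ?(ltW delta_gt0) //.
  by rewrite exprMn delta_sqr -exprM; apply: le_trans aK; lra.
apply: (@le_trans _ _ (alpha ^+ 2 * delta * delta)).
  by rewrite ler_pM2r //; apply: le_trans a2d; lra.
by rewrite -mulrA ler_pM2l ?exprn_gt0 // -expr2 delta_sqr.
Qed.
End Estimates.

(** * The Lyapunov function of MBP and its drift *)

Section Mirror.
Variables (R : realType) (G : model R) (K : nat).
Hypothesis K_gt0 : (0 < K)%N.
Implicit Types (q : state G) (i j k : node G) (tau : demand G) (n : nat).

Let m : R := #|node G|%:R.
Let delta : R := Num.sqrt K%:R.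
Let Kt : R := K%:R + m * delta.
Let A : R := Num.sqrt (m * Kt).
Let root n : R := Num.sqrt (n%:R + delta).

Definition price q i : R := inv_sqrt_congestion #|node G| (qbar K q i).

(** Convex in the queue lengths, with partial derivatives [- A / root (q i)]; by [priceE] these are
    the prices. *)
Definition lyapunov q : R := - (2 * A) * \sum_i root (q i).

Let m_ge2 : 2 <= m.
Proof. by rewrite /m ler_nat node_gt1. Qed.

Let K_ge1 : 1 <= K%:R :> R.
Proof. by rewrite ler1n. Qed.

Let delta_sqr : delta ^+ 2 = K%:R.
Proof. by rewrite sqr_sqrtr ?ler0n. Qed.

Let delta_ge1 : 1 <= delta.
Proof. by rewrite -[1]sqrtr1 ler_sqrt // ltr0n. Qed.

Let Kt_geK : K%:R <= Kt.
Proof. by rewrite lerDl mulr_ge0 //; move: m_ge2 delta_ge1; lra. Qed.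

Let A_sqr : A ^+ 2 = m * Kt.
Proof. by rewrite sqr_sqrtr // mulr_ge0 //; move: m_ge2 Kt_geK K_ge1; lra. Qed.

Let A_gt0 : 0 < A.
Proof.
by rewrite sqrtr_gt0 mulr_gt0 //; move: m_ge2 Kt_geK K_ge1; lra.
Qed.

Let root_sqr n : root n ^+ 2 = n%:R + delta.
Proof. by rewrite sqr_sqrtr // addr_ge0 //; move: delta_ge1; lra. Qed.

Let root_gt0 n : 0 < root n.
Proof. by rewrite sqrtr_gt0 ltr_wpDl //; move: delta_ge1; lra. Qed.

Lemma priceE q i : price q i = - A / root (q i).
Proof.
have Kt0 : 0 < Kt by move: K_ge1 Kt_geK; lra.
have num0 : 0 <= (q i)%:R + delta by rewrite -root_sqr exprn_ge0 ?ltW.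
rewrite /price /inv_sqrt_congestion /qbar -/m -/delta -/Kt powRN powR12_sqrt.
  rewrite sqrtrM // sqrtrV ?ltW // -/(root (q i)) /A sqrtrM; last first.
    by move: m_ge2; lra.
  by field; rewrite (lt0r_neq0 (root_gt0 _)) lt0r_neq0 ?sqrtr_gt0.
by rewrite divr_ge0 // ltW.
Qed.

(** Since r - s = 1 / (r + s), the increment of twice the square root differs from the derivative at
    either endpoint by at most the inverse cube there. *)
Lemma sqrt_succ_bounds (r s : R) : 0 < s -> 0 < r -> r ^+ 2 = s ^+ 2 + 1 ->
  2 * (r - s) <= r^-1 + r ^- 3 /\ s^-1 - s ^- 3 <= 2 * (r - s).
Proof.
move=> s0 r0 rs.
have sr : s <= r by rewrite -(@ler_pXn2r _ 2) ?nnegrE ?ltW // rs; lra.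
have srB : 0 <= r - s by rewrite subr_ge0.
have drs : 0 < r + s by lra.
have rsE : r - s = (r + s)^-1.
  apply: (mulfI (lt0r_neq0 drs)); rewrite mulfV ?lt0r_neq0 //.
  by move: rs; rewrite !expr2; lra.
rewrite rsE; split.
  rewrite -subr_ge0.
  have -> : r^-1 + r ^- 3 - 2 * (r + s)^-1 =
            ((r ^+ 2 + 1) * (r + s) - 2 * r ^+ 3) / (r ^+ 3 * (r + s)).
    by field; rewrite !lt0r_neq0.
  apply: divr_ge0; last by rewrite mulr_ge0 ?exprn_ge0 ?ltW.
  (* The subtracted term is a multiple of the constraint [rs] and vanishes; the remaining term is
     visibly nonnegative. *)
  have -> : (r ^+ 2 + 1) * (r + s) - 2 * r ^+ 3 =
     s * (r ^+ 2 + 1 - r * s) - r * (r ^+ 2 - (s ^+ 2 + 1)) by ring.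
  rewrite [X in r * (X - _)]rs subrr mulr0 subr0; apply: mulr_ge0; first exact: ltW.
  by have := mulr_ge0 (ltW r0) srB; rewrite mulrBr -expr2; lra.
rewrite -subr_ge0.
have -> : 2 * (r + s)^-1 - (s^-1 - s ^- 3) =
          (2 * s ^+ 3 - (s ^+ 2 - 1) * (r + s)) / (s ^+ 3 * (r + s)).
  by field; rewrite !lt0r_neq0.
apply: divr_ge0; last by rewrite mulr_ge0 ?exprn_ge0 ?ltW.
have -> : 2 * s ^+ 3 - (s ^+ 2 - 1) * (r + s) =
   r * (r * s - s ^+ 2 + 1) - s * (r ^+ 2 - (s ^+ 2 + 1)) by ring.
rewrite [X in s * (X - _)]rs subrr mulr0 subr0; apply: mulr_ge0; first exact: ltW.
by have := mulr_ge0 (ltW s0) srB; rewrite mulrBr -expr2; lra.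
Qed.

(** The error is measured at the old length [n]: a step up uses the lower bound of
    [sqrt_succ_bounds], a step down the upper one. A queue that does not move pays nothing. *)
Lemma lyapunov_coordinate n n' : [|| n' == n, n' == n.+1 | n == n'.+1] ->
  - A / root n * (n%:R - n'%:R) - A / root n ^+ 3 * (n != n')%:R <=
  2 * A * root n' - 2 * A * root n.
Proof.
have A0 := A_gt0.
case/or3P=> /eqP->.
- by rewrite eqxx /= !subrr !mulr0 subr0.
- have [|||_] := @sqrt_succ_bounds (root n.+1) (root n) => //.
    by rewrite !root_sqr -natr1; lra.
  rewrite -(ler_pM2l A0) (_ : (n != n.+1) = true); last by lia.
  by rewrite /= mulr1 -natr1; lra.
- have [|||+ _] := @sqrt_succ_bounds (root n'.+1) (root n') => //.
    by rewrite !root_sqr -natr1; lra.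
  rewrite -(ler_pM2l A0) (_ : (n'.+1 != n') = true); last by lia.
  by rewrite /= mulr1 -natr1; lra.
Qed.

(** When MBP serves, its score equals [best], and passing from prices to the increment of [lyapunov]
    costs [E] at each of the two affected nodes. When it drops because of a negative score, [best]
    is 0. Only an empty source queue costs more. *)
Lemma mbp_drift pi q h tau x (E : R) :
  is_MBP K (inv_sqrt_congestion #|node G|) pi -> Omega G K q ->
  0 < decide pi h q tau x ->
  (forall i, A / root (q i) ^+ 3 <= E) ->
  best (price q) tau - (2 * E + [exists i, q i == 0%N]%:R) <=
  collected tau x + lyapunov q - lyapunov (step q tau x).
Proof.
move=> mbp Kq d0 hE.
have E0 : 0 <= E.
  have /card_gt0P[i _] : (0 < #|node G|)%N := ltnW (node_gt1 G).
  by apply: le_trans (hE i); rewrite divr_ge0 ?exprn_ge0 ?ltW.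
have [j [k [[jP kD smax] ->]]] := mbp _ _ _ _ Kq d0.
rewrite mbp_decisionE collected_unit //.
have -> : score K (inv_sqrt_congestion #|node G|) q tau j k =
          payoff j tau k + price q j - price q k by [].
set b := _ && _.
have bq : b ==> (0 < q j)%N by apply/implyP => /andP[].
have best_score c : 0 <= c -> payoff j tau k + price q j - price q k <= c ->
    best (price q) tau <= c.
  move=> c0 sc; apply: best_le => // j' k' jP' kD'.
  exact: le_trans (smax _ _ jP' kD') sc.
case: (boolP b) bq => hb bq; last first.
  have -> : step q tau (unit_decision j tau k false) = q.
    by apply/ffunP => i; rewrite step_unit // !muln0 addn0 subn0.
  rewrite mulr0 addrK subr_le0.
  have : ~~ (0 <= payoff j tau k + price q j - price q k) || (q j == 0%N).
    by move: hb; rewrite /b negb_and -leqNgt leqn0.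
  case/orP => [|qj0].
    rewrite -ltNge => /ltW s0; apply: (le_trans (best_score 0 _ s0)) => //.
    by rewrite addr_ge0 ?mulr_ge0.
  have -> : [exists i, q i == 0%N] by apply/existsP; exists j.
  apply: best_score => /=; first by lra.
  (* An empty queue has the lowest price, so the missed score is at most its payoff, hence at most
     1. *)
  suff : price q j <= price q k.
    by have := payoff_bound jP kD; rewrite ler_norml => /andP[]; lra.
  rewrite !priceE !mulNr lerN2 ler_pM2l // lef_pV2 ?posrE ?root_gt0 //.
  by apply: ler_wsqrtr; rewrite (eqP qj0) lerD2r ler_nat.
have /andP[s0 qj] := hb.
set q' := step _ _ _.
have := @sum_step_unit _ _ (price q) q tau j k true jP kD bq.
rewrite -/q' mulr1 => sumE.
have steps : \sum_i ((q i != q' i)%:R : R) <= 2.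
  apply: (@le_trans _ _ (\sum_i ((i == j)%:R + (i == k)%:R))).
    apply: ler_sum => i _; rewrite -natrD ler_nat /q' step_unit //.
    by rewrite ![_ == i]eq_sym; exact: unit_move_neq.
  have sum1 i0 : \sum_i (i == i0)%:R = 1 :> R.
    by rewrite (bigD1 i0) //= eqxx big1 ?addr0 // => i /negPf->.
  by rewrite big_split /= !sum1; lra.
have drift : \sum_i (price q i * ((q i)%:R - (q' i)%:R) - E * (q i != q' i)%:R)
    <= \sum_i (2 * A * root (q' i) - 2 * A * root (q i)).
  apply: ler_sum => i _; rewrite priceE.
  apply: le_trans (lyapunov_coordinate _).
    by rewrite lerD2l lerN2 ler_wpM2r.
  rewrite /q' step_unit // ![_ == i]eq_sym.
  by apply: unit_move_adjacent; case: eqP => // ->.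
move: drift; rewrite !sumrB -!mulr_sumr.
under eq_bigr do rewrite mulrBr.
rewrite sumrB sumE.
have := best_score _ s0 (lexx _); have := ler_wpM2l E0 steps.
rewrite /lyapunov.
have : 0 <= [exists i, q i == 0%N]%:R :> R by [].
rewrite /= mulr1; lra.
Qed.

Lemma lyapunov_le0 q : lyapunov q <= 0.
Proof.
rewrite /lyapunov mulNr oppr_le0 mulr_ge0 //; first by move: A_gt0; lra.
by apply: sumr_ge0 => i _; exact: ltW.
Qed.

Lemma sum_root_sqr q : Omega G K q -> \sum_i root (q i) ^+ 2 = Kt.
Proof.
move=> Kq; under eq_bigr do rewrite root_sqr.
by rewrite big_split /= -natr_sum Kq sumr_const /Kt /m mulr_natl.
Qed.

(** By AM-GM each [2 * A * root (q i)] is at most [Kt + m * root (q i) ^+ 2], because A^2 = m Kt.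
    Summing gives 2 m Kt, and [m <= delta] yields Kt <= 2K. *)
Lemma lyapunov_ge q : m <= delta -> Omega G K q -> - (4 * m * K%:R) <= lyapunov q.
Proof.
move=> md Kq; have Kt0 : 0 < Kt by move: K_ge1 Kt_geK; lra.
have amgm i : 2 * A * root (q i) <= Kt + m * root (q i) ^+ 2.
  rewrite -(ler_pM2l Kt0); have := sqr_ge0 (Kt - A * root (q i)).
  rewrite sqrrB [(A * _) ^+ 2]exprMn A_sqr; lra.
have : \sum_i 2 * A * root (q i) <= \sum_i (Kt + m * root (q i) ^+ 2).
  by apply: ler_sum => i _; exact: amgm.
rewrite big_split /= sumr_const -!mulr_sumr sum_root_sqr // -[Kt *+ _]mulr_natl -/m.
have : m * delta <= delta ^+ 2 by rewrite expr2 ler_wpM2r //; move: delta_ge1; lra.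
rewrite delta_sqr => h1; have : m * Kt <= m * (2 * K%:R).
  by rewrite ler_wpM2l // /Kt; lra.
rewrite /lyapunov; lra.
Qed.

(** The error is largest at the shortest queue, and the cases depend on its price. If that price is
    at least -6m, no queue is empty and the error is O(m^2 / K). Otherwise the spread of prices is
    large, and its two halves pay for the error and for idling. *)
Lemma price_gap q (alpha : R) : Omega G K q -> 0 < alpha ->
  1297 * m ^+ 2 + 256 * alpha ^- 4 + 64 * alpha ^- 2 <= K%:R ->
  exists E i j, (forall i, A / root (q i) ^+ 3 <= E) /\
    2 * E + [exists i, q i == 0%N]%:R <=
    alpha * Num.max 0 (price q i - price q j - 2 * m) + 432 * m ^+ 2 / K%:R.
Proof.
move=> Kq a0 hK.
have m2 := m_ge2; have A0 := A_gt0; have K1 := K_ge1; have d1 := delta_ge1.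
have [hK1 hK2 hK3] : [/\ 1297 * m ^+ 2 <= K%:R, 256 <= alpha ^+ 4 * K%:R &
                         64 <= alpha ^+ 2 * K%:R].
  have h n : 0 < alpha ^- n by rewrite invr_gt0 exprn_gt0.
  have m0 : 0 <= m ^+ 2 by rewrite exprn_ge0; lra.
  have h4 := h 4%N; have h2 := h 2%N.
  split; first lra.
    by rewrite -ler_pdivrMl ?exprn_gt0 // mulrC; lra.
  by rewrite -ler_pdivrMl ?exprn_gt0 // mulrC; lra.
have /card_gt0P[a _] : (0 < #|node G|)%N := ltnW (node_gt1 G).
have [i0 hi0] : exists i0, forall i, (q i0 <= q i)%N.
  by exists [arg min_(i < a) q i]; case: arg_minnP => // i _ h j; exact: h.
have [i1 hi1] : exists i1, forall i, (q i <= q i1)%N.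
  by exists [arg max_(i > a) q i]; case: arg_maxnP => // i _ h j; exact: h.
set r0 := root (q i0); have r00 : 0 < r0 := root_gt0 _.
(* The longest queue is at least the average, which keeps its price above -m. *)
have r1 : A <= m * root (q i1).
  have m0 : 0 <= m by lra.
  have rt0 := ltW (root_gt0 (q i1)); have A0' := ltW A0.
  rewrite -(@ler_pXn2r _ 2) ?nnegrE ?mulr_ge0 // exprMn A_sqr.
  rewrite expr2 -mulrA ler_wpM2l // -(sum_root_sqr Kq) /m mulr_natl -sumr_const.
  by apply: ler_sum => i _; rewrite !root_sqr lerD2r ler_nat.
have pi1 : - m <= price q i1.
  by rewrite priceE mulNr lerN2 ler_pdivrMr.
have pi0 : price q i0 = - (A / r0) by rewrite priceE mulNr.
have r0d : delta <= r0 ^+ 2 by rewrite root_sqr lerDr.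
have z0 : [exists i, q i == 0%N] -> r0 ^+ 2 = delta.
  case/existsP => i /eqP qi; rewrite root_sqr.
  have -> : q i0 = 0%N by have := hi0 i; rewrite qi leqn0 => /eqP.
  by rewrite add0r.
exists (A / r0 ^+ 3), i1, i0; split.
  move=> i; rewrite ler_pM2l // lef_pV2 ?posrE ?exprn_gt0 //.
  rewrite ler_pXn2r ?nnegrE ?(ltW (root_gt0 _)) //; apply: ler_wsqrtr.
  by rewrite lerD2r ler_nat.
have A2K : m * K%:R <= A ^+ 2 by rewrite A_sqr ler_wpM2l //; lra.
have m0 : 0 < m by lra.
have d0 : 0 < delta by lra.
have K0 : 0 < K%:R :> R by lra.
have AK : K%:R <= A ^+ 2 by apply: le_trans A2K; rewrite ler_peMl ?ltW //; lra.
have [small|large] := leP A (6 * m * r0).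
  have -> : [exists i, q i == 0%N] = false.
    apply/negbTE/negP => ex0.
    have := large_price_at_empty m0 d0 A0 delta_sqr A2K (z0 ex0) hK1.
    by rewrite ltNge small.
  rewrite addr0; apply: ler_wpDl (small_price_error _ _ _ _ _ small) => //.
  by rewrite mulr_ge0 ?le_max ?lexx // ltW.
(* The spread is at least [A / r0 - m]; subtracting 2m more still leaves half of [A / r0], as that
   is at least 6m. *)
have gain : A / r0 / 2 <= Num.max 0 (price q i1 - price q i0 - 2 * m).
  rewrite le_max; apply/orP; right; rewrite pi0.
  have : 6 * m <= A / r0 by rewrite ler_pdivlMr // ltW.
  lra.
have c0 : 0 <= 432 * m ^+ 2 / K%:R.
  by apply: divr_ge0 (ltW K0); apply: mulr_ge0 (exprn_ge0 _ (ltW m0)).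
apply: (@le_trans _ _ (alpha * (A / r0 / 2))); last first.
  by apply: ler_wpDr => //; rewrite ler_wpM2l // ltW.
rewrite [leRHS]splitr; apply: lerD.
  exact: (large_price_error d0 A0 r00 a0 delta_sqr r0d hK3).
case: (boolP [exists i, q i == 0%N]) => [ex0|_].
  exact: (large_price_gain d0 A0 r00 a0 delta_sqr (z0 ex0) AK hK2).
by rewrite !mulr_ge0 ?invr_ge0 ?(ltW a0) ?(ltW A0) ?(ltW r00).
Qed.

(** The benchmark [w t] lies below the dual at the current prices by the connectedness excess, and
    [price_gap] spends that excess on the one-period loss of MBP. *)
Lemma mbp_value_ge (phi : nat -> demand G -> R) (pi : policy G) (T : nat)
    (alpha : R) (w : nat -> R) q :
  (forall t, (1 <= t <= T)%N -> prob_vector (phi t)) ->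
  (forall t, (1 <= t <= T)%N -> alpha <= connectedness (phi t)) ->
  0 < alpha ->
  1297 * m ^+ 2 + 256 * alpha ^- 4 + 64 * alpha ^- 2 <= K%:R ->
  is_MBP K (inv_sqrt_congestion #|node G|) pi ->
  (forall t q, (1 <= t <= T)%N -> Omega G K q -> forall i j,
     w t + connectedness (phi t) * Num.max 0 (price q i - price q j - 2 * m) <=
     fluid_dual (phi t) (price q)) ->
  Omega G K q ->
  \sum_(1 <= s < T.+1) w s - T%:R * (432 * m ^+ 2 / K%:R) - 4 * m * K%:R <=
  value phi pi (@collected R G) T 1 [::] q.
Proof.
move=> pv ha a0 hK mbp hw Kq.
have md : m <= delta.
  have m0 : 0 <= m by move: m_ge2; lra.
  rewrite -(@ler_pXn2r _ 2) ?nnegrE ?sqrtr_ge0 // delta_sqr.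
  apply: le_trans hK; have := exprn_ge0 2 m0.
  have h n : 0 <= alpha ^- n by rewrite invr_ge0 exprn_ge0 ?ltW.
  by have := h 4%N; have := h 2%N; lra.
have : value phi pi (fun tau x => - collected tau x) T 1 [::] q <=
    \sum_(1 <= s < T.+1) - (w s - 432 * m ^+ 2 / K%:R) +
    (lyapunov q + 4 * m * K%:R).
  (* The shift by 4mK makes the final potential nonnegative; the initial one is then at most 4mK,
     since [lyapunov] is nonpositive. *)
  apply: (@value_le _ _ phi pi T K pv _ _ (fun _ q => lyapunov q + 4 * m * K%:R)) => //.
    move=> t h q' tT Kq'; have [E [i [j [hE gap]]]] := price_gap Kq' a0 hK.
    exists (fun tau => - (best (price q') tau - (2 * E + [exists i, q' i == 0%N]%:R))).
      have [p0 p1] := pv _ tT.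
      under eq_bigr do rewrite mulrN mulrBr.
      rewrite sumrN lerN2 sumrB -mulr_suml p1 mul1r -/(fluid_dual _ _).
      have max0 : 0 <= Num.max 0 (price q' i - price q' j - 2 * m).
        by rewrite le_max lexx.
      have := hw _ _ tT Kq' i j; have := ler_wpM2r max0 (ha _ tT).
      by lra.
    by move=> tau x dx; have := mbp_drift mbp Kq' dx hE; lra.
  by move=> q' Kq'; have := lyapunov_ge md Kq'; lra.
rewrite value_opp sumrN sumrB sumr_const_nat subn1 /= -[_ *+ T]mulr_natl.
by have := lyapunov_le0 q; lra.
Qed.
End Mirror.

(** * Upper bound for an arbitrary policy *)

Section UpperBound.
Variables (R : realType) (G : model R) (K : nat) (phi : nat -> demand G -> R).
Implicit Types (q : state G) (t : nat).
Let m : R := #|node G|%:R.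

(** Weak duality with prices that may change only after a multiple of [B]. Inside a block the
    pairing of prices and queues telescopes; each change of prices, and the initial state, costs at
    most 2mK. *)
Lemma any_value_le (pi : policy G) (T B : nat) (Y : nat -> node G -> R) q :
  (forall t, (1 <= t <= T)%N -> prob_vector (phi t)) ->
  (forall t i j, Y t i - Y t j <= 2 * m) ->
  (forall t, ~~ (B %| t)%N -> Y t.+1 = Y t) ->
  Omega G K q ->
  value phi pi (@collected R G) T 1 [::] q <=
    \sum_(1 <= s < T.+1) (fluid_dual (phi s) (Y s) + (B %| s)%N%:R * (2 * m * K%:R)) +
    2 * m * K%:R.
Proof.
move=> pv spread Yconst Kq.
have /card_gt0P[a _] : (0 < #|node G|)%N := ltnW (node_gt1 G).
have natK q' : Omega G K q' -> \sum_i (q' i)%:R = K%:R :> R.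
  by move=> <-; rewrite natr_sum.
have [imax himax] := choice (fun y : node G -> R => exists_argmin a (fun i => - y i)).
pose top y := y (imax y).
have topP y i : y i <= top y by rewrite -lerN2; exact: himax.
(* On states with K units this is minus the pairing of prices and queues, shifted by a constant for
   fixed [t]. The shift places it between 0 and 2mK. *)
pose Psi t q' := \sum_i (top (Y t) - Y t i) * (q' i)%:R.
have PsiE t q' : Omega G K q' ->
    Psi t q' = top (Y t) * K%:R - \sum_i Y t i * (q' i)%:R.
  move=> Kq'; rewrite /Psi; under eq_bigr do rewrite mulrBl.
  by rewrite sumrB -mulr_sumr natK.
have Psi_ge0 t q' : 0 <= Psi t q'.
  by apply: sumr_ge0 => i _; rewrite mulr_ge0 // subr_ge0.
have Psi_le t q' : Omega G K q' -> Psi t q' <= 2 * m * K%:R.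
  move=> Kq'; rewrite -(natK _ Kq') mulr_sumr; apply: ler_sum => i _.
  by apply: ler_wpM2r => //; exact: spread.
apply: (@le_trans _ _ (\sum_(1 <= s < T.+1)
    (fluid_dual (phi s) (Y s) + (B %| s)%N%:R * (2 * m * K%:R)) + Psi 1%N q)); last first.
  by rewrite lerD2l; exact: Psi_le.
apply: (@value_le _ _ phi pi T K pv _ _ Psi) => //.
move=> t h q' tT Kq'.
exists (fun tau => best (Y t) tau + (B %| t)%N%:R * (2 * m * K%:R)).
  have [p0 p1] := pv _ tT; under eq_bigr do rewrite mulrDr.
  by rewrite big_split /= -mulr_suml p1 mul1r.
move=> tau x dx; have fx := decide_feasible dx.
have Kq1 := feasible_Omega fx Kq'; have := collected_le_best (Y t) fx.
have := PsiE t _ Kq'; have := PsiE t _ Kq1.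
case: (boolP (B %| t)%N) => [_|/Yconst tB] /=.
  by have := Psi_le t.+1 _ Kq1; have := Psi_ge0 t (step q' tau x); lra.
have PsiS : Psi t.+1 = Psi t by rewrite /Psi tB.
by rewrite PsiS; lra.
Qed.

(** [Y t] minimizes the dual only over the finitely many compressed price vectors that come from
    queue vectors with entries up to K. An argmin over a finite type thus stands in for a true
    minimizer, and comparison with every [Y s] suffices to change periods. *)
Lemma fluid_prices : exists Y : nat -> node G -> R,
  [/\ forall t i j, Y t i - Y t j <= 2 * m,
      forall s t, fluid_dual (phi t) (Y t) <= fluid_dual (phi t) (Y s) &
      forall t q, prob_vector (phi t) -> 0 <= connectedness (phi t) ->
        Omega G K q -> forall i j,
        fluid_dual (phi t) (Y t) + connectedness (phi t) *
          Num.max 0 (price K q i - price K q j - 2 * m) <=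
        fluid_dual (phi t) (price K q)].
Proof.
pose decode (Q : {ffun node G -> 'I_K.+1}) : state G := [ffun i => Q i : nat].
have [C HC] := choice (fun Q => compress_prices (price K (decode Q))).
pose Q0 : {ffun node G -> 'I_K.+1} := [ffun=> ord0].
have [Qmin HQ] := choice (fun t => exists_argmin Q0 (fun Q => fluid_dual (phi t) (C Q))).
exists (fun t => C (Qmin t)); split=> [t i j|s t|t q pp cp Kq i j] //.
  exact: (HC _).1.
have -> : q = decode [ffun i => inord (q i)].
  apply/ffunP => k; rewrite !ffunE inordK // ltnS -Kq.
  by rewrite (bigD1 k) //= leq_addr.
set Q := finfun _.
apply: (@le_trans _ _ (fluid_dual (phi t) (C Q) + connectedness (phi t) *
    Num.max 0 (price K (decode Q) i - price K (decode Q) j - 2 * m))).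
  by rewrite lerD2r.
exact: (HC _).2.
Qed.

(** * Blocks of periods and the drift of the rates *)

Let dphi t : R := \sum_tau `|phi t.+1 tau - phi t tau|.

Lemma rate_drift b n :
  \sum_tau `|phi (b + n)%N tau - phi b tau| <= \sum_(b <= t < b + n) dphi t.
Proof.
elim: n => [|n IH].
  by rewrite addn0 big_geq // big1 // => tau _; rewrite subrr normr0.
rewrite addnS big_nat_recr ?leq_addr //=.
apply: le_trans (lerD IH (lexx _)); rewrite -big_split /=.
apply: ler_sum => tau _; rewrite addrC.
by rewrite (_ : phi (b + n).+1 tau - phi b tau =
  (phi (b + n).+1 tau - phi (b + n)%N tau) + (phi (b + n)%N tau - phi b tau)) ?ler_normD //; ring.
Qed.

(** The second argument of the minimum strengthens the claim so that the induction on [N] closes. *)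
Lemma count_window t B N :
  (\sum_(1 <= s < N) (t < s < t + B) <= minn B.-1 (N - t.+1))%N.
Proof.
elim: N => [|N IH]; first by rewrite big_geq.
case: N IH => [|N] IH; first by rewrite big_geq.
rewrite big_nat_recr //=.
case: (ltnP t N.+1) => tN; case: (ltnP N.+1 (t + B)) => NB /=; lia.
Qed.

Lemma count_multiples B T :
  (0 < B)%N -> (\sum_(1 <= s < T.+1) (B %| s) = T %/ B)%N.
Proof.
move=> B0; elim: T => [|T IH]; first by rewrite big_geq // div0n.
by rewrite big_nat_recr //= IH divnS // addnC.
Qed.

(** The first period of the block containing [s]; as periods start at 1, blocks end at the multiples
    of [B]. *)
Definition block B s : nat := (1 + B * (s.-1 %/ B))%N.

Lemma blockS B s : (0 < B)%N -> (0 < s)%N -> ~~ (B %| s)%N ->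
  block B s.+1 = block B s.
Proof.
by case: s => // s B0 _ /negPf ns; rewrite /block /= divnS // ns.
Qed.

Lemma block_le B s : (0 < s)%N -> (1 <= block B s <= s)%N.
Proof.
by case: s => // s _; rewrite /block /= add1n ltnS mulnC leq_trunc_div.
Qed.

Lemma block_gt B s : (0 < B)%N -> (0 < s)%N -> (s < block B s + B)%N.
Proof.
case: s => // s B0 _; rewrite /block /=.
by have := ltn_pmod s B0; have := divn_eq s B; lia.
Qed.

(** Exchanging the sums, the variation at [t] is charged only to later periods of its block, at most
    B - 1 of them. *)
Lemma sum_block_drift B T : (0 < B)%N ->
  \sum_(1 <= s < T.+1) \sum_(block B s <= t < s) dphi t <=
  B.-1%:R * \sum_(1 <= t < T) dphi t.
Proof.
move=> B0.
have dphi0 t : 0 <= dphi t by apply: sumr_ge0.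
apply: (@le_trans _ _ (\sum_(1 <= s < T.+1) \sum_(1 <= t < T)
    dphi t * (t < s < t + B)%N%:R)).
  rewrite big_nat [leRHS]big_nat; apply: ler_sum => s /andP[s1 sT].
  have /andP[b1 bs] := block_le B s1; have bB := block_gt B0 s1.
  rewrite [leRHS](@big_cat_nat _ _ _ (block B s)) //=; last by lia.
  rewrite [X in _ <= _ + X](@big_cat_nat _ _ _ s) //=.
  have h u v : 0 <= \sum_(u <= t < v) dphi t * (t < s < t + B)%N%:R.
    by apply: sumr_ge0 => t _; rewrite mulr_ge0.
  rewrite addrCA ler_wpDr ?addr_ge0 // big_nat [leRHS]big_nat.
  apply: ler_sum => t /andP[bt ts].
  by rewrite ts (leq_trans bB) ?leq_add2r ?mulr1.
rewrite exchange_big /= mulr_sumr; apply: ler_sum => t _.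
rewrite -mulr_sumr mulrC ler_wpM2r // -natr_sum ler_nat.
exact: leq_trans (count_window _ _ _) (geq_minl _ _).
Qed.
End UpperBound.

(** * Comparison of the two bounds *)

(** Balances the drift cost (B - 1) eta against the cost K / B of restarting blocks, with [B] the
    least integer above sqrt(K / eta). *)
Lemma block_length (R : realType) (K T : nat) (eta : R) : 0 <= eta ->
  exists2 B : nat, (0 < B)%N &
    B.-1%:R * eta <= Num.sqrt (eta * K%:R) /\
    K%:R * (T %/ B)%N%:R <= T%:R * Num.sqrt (eta * K%:R).
Proof.
rewrite le_eqVlt => /orP[/eqP<-|eta0].
  (* With constant rates a single block longer than the horizon never ends. *)
  by exists T.+1; rewrite // mul0r sqrtr0 !mulr0 divn_small // mulr0.
set x := Num.sqrt (K%:R / eta).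
have x0 : 0 <= x by exact: sqrtr_ge0.
have x2 : eta * (x * x) = K%:R.
  by rewrite -expr2 sqr_sqrtr ?divr_ge0 ?(ltW eta0) // mulrC divfK ?gt_eqF.
have -> : Num.sqrt (eta * K%:R) = eta * x.
  rewrite -x2 (_ : eta * _ = (eta * x) ^+ 2); last by ring.
  by rewrite sqrtr_sqr ger0_norm // mulr_ge0 // ltW.
have /andP[xl xu] := truncn_itv x0.
exists (Num.truncn x).+1 => //; split; first by rewrite mulrC ler_pM2l.
set B := (Num.truncn x).+1.
rewrite -{1}x2 (_ : _ * _%:R = (eta * x) * (x * (T %/ B)%N%:R)); last by ring.
rewrite [leRHS]mulrC ler_wpM2l ?mulr_ge0 ?(ltW eta0) //.
apply: (@le_trans _ _ (B%:R * (T %/ B)%N%:R)).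
  by rewrite ler_wpM2r // ltW.
by rewrite -natrM ler_nat mulnC leq_trunc_div.
Qed.

(** * The minimal connectedness over the horizon *)

Section AlphaMin.
Variables (R : realType) (G : model R) (phi : nat -> demand G -> R) (T : nat).
Hypothesis conn_gt0 : forall t, (1 <= t <= T)%N -> 0 < connectedness (phi t).

Lemma alpha_min_le t : (1 <= t <= T)%N -> alpha_min phi T <= connectedness (phi t).
Proof.
move=> tT; apply: ge_inf; last by exists t.
by exists 0 => _ [s sT <-]; exact/ltW/conn_gt0.
Qed.

Lemma alpha_min_gt0 : (0 < T)%N -> 0 < alpha_min phi T.
Proof.
move=> T0.
have [i hi] := exists_argmin (Ordinal T0) (fun i : 'I_T => connectedness (phi i.+1)).
apply: (@lt_le_trans _ _ (connectedness (phi i.+1))).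
  by apply: conn_gt0; rewrite /= ltn_ord.
apply: lb_le_inf; first by exists (connectedness (phi 1%N)), 1%N; rewrite //= T0.
move=> _ [[|t] //= tT <-].
exact: hi (Ordinal tT).
Qed.
End AlphaMin.

Lemma sum_variation_le (R : realType) (D : finType) (phi : nat -> D -> R) (T : nat)
    (eta : R) : (0 < T)%N -> 0 <= eta -> slowly_varying phi T eta ->
  \sum_(1 <= t < T) \sum_tau `|phi t.+1 tau - phi t tau| <= T%:R * eta.
Proof.
(* For a horizon of one period [slowly_varying] is vacuous, but the sum is empty. *)
case: T => [//|[|T]] _ eta0 sv; first by rewrite big_geq // mulr_ge0.
apply: (@le_trans _ _ (T.+1%:R * eta)); last by rewrite ler_wpM2r // ler_nat.
by have := sv isT; rewrite mulrC ler_pdivrMr ?ltr0n // mulrC.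
Qed.

(** * From total values to the loss *)

Section Assembly.
Variables (R : realType) (G : model R) (K T : nat) (phi : nat -> demand G -> R).
Hypothesis T_gt0 : (0 < T)%N.

Lemma loss_le (pi : policy G) (u l : R) :
  (forall pi' q, Omega G K q -> value phi pi' (@collected R G) T 1 [::] q <= u) ->
  (forall q, Omega G K q -> l <= value phi pi (@collected R G) T 1 [::] q) ->
  loss K phi T pi <= T%:R^-1 * (u - l).
Proof.
move=> hu hl.
have T0 : 0 < T%:R^-1 :> R by rewrite invr_gt0 ltr0n.
have /card_gt0P[a _] : (0 < #|node G|)%N := ltnW (node_gt1 G).
(* All units at one node: a witness that the sets under [sup] and [inf] are nonempty. *)
pose q0 : state G := [ffun i => if i == a then K else 0%N].
have Kq0 : Omega G K q0.
  rewrite /Omega /= (bigD1 a) //= ffunE eqxx big1 ?addn0 // => i /negPf ia.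
  by rewrite ffunE ia.
rewrite /loss mulrBr; apply: lerB.
  apply: ge_sup.
    by exists (sup [set average_payoff phi T pi q | q in Omega G K]%classic), pi.
  move=> _ [pi' _ <-]; apply: ge_sup; first by exists (average_payoff phi T pi' q0), q0.
  by move=> _ [q Kq <-]; rewrite /average_payoff sum_expected_payoff ler_pM2l ?hu.
apply: lb_le_inf; first by exists (average_payoff phi T pi q0), q0.
by move=> _ [q Kq <-]; rewrite /average_payoff sum_expected_payoff ler_pM2l ?hl.
Qed.

(** Pass from the rates of period [s] to those at the start of its block, use minimality there, and
    pass back. Each passage costs 1 + 2m times the variation, and 2 + 4m <= 6m. *)
Lemma sum_dual_block_le (Y : nat -> node G -> R) (B : nat) :
  let m : R := #|node G|%:R in
  (forall t i j, Y t i - Y t j <= 2 * m) ->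
  (forall s t, fluid_dual (phi t) (Y t) <= fluid_dual (phi t) (Y s)) ->
  (0 < B)%N ->
  \sum_(1 <= s < T.+1) fluid_dual (phi s) (Y (block B s)) <=
  \sum_(1 <= s < T.+1) fluid_dual (phi s) (Y s) + 6 * m *
    (B.-1%:R * \sum_(1 <= t < T) \sum_tau `|phi t.+1 tau - phi t tau|).
Proof.
move=> m spread Ymin B0.
have m2 : 2 <= m by rewrite ler_nat node_gt1.
have m0 : 0 <= 2 * m by lra.
apply: (@le_trans _ _ (\sum_(1 <= s < T.+1) (fluid_dual (phi s) (Y s) + 6 * m *
    \sum_(block B s <= t < s) \sum_tau `|phi t.+1 tau - phi t tau|))); last first.
  rewrite big_split /= -mulr_sumr lerD2l ler_wpM2l //; first by lra.
  exact: sum_block_drift.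
rewrite big_nat [leRHS]big_nat; apply: ler_sum => s /andP[s1 _].
have /andP[_ bs] := block_le B s1.
set b := block B s in bs *.
have := rate_drift phi b (s - b); rewrite subnKC //.
set V := \sum_(b <= t < s) _ => hV.
have V0 : 0 <= V by do 2![apply: sumr_ge0 => ? _].
have h1 := dual_lipschitz (phi s) (phi b) m0 (spread b).
have h2 := dual_lipschitz (phi b) (phi s) m0 (spread s).
have h3 := Ymin s b.
have hV' : \sum_tau `|phi b tau - phi s tau| <= V.
  by under eq_bigr do rewrite distrC.
have m1 : 0 <= 1 + 2 * m by lra.
have := ler_wpM2l m1 hV; have := ler_wpM2l m1 hV'.
have : 0 <= (m - 2) * V by rewrite mulr_ge0 //; lra.
by move: h1 h2 h3; lra.
Qed.
End Assembly.

Theorem theorem1 (R : realType) :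
  exists (P : {poly {poly R}}) (C : R),
    forall (G : model R) (K T : nat) (phi : nat -> demand G -> R) (eta : R)
           (pi : policy G),
      let m := #|node G| in
      (0 < K)%N -> (0 < T)%N -> 0 <= eta ->
      (forall t, (1 <= t <= T)%N -> prob_vector (phi t)) ->
      (forall t, (1 <= t <= T)%N -> 0 < connectedness (phi t)) ->
      slowly_varying phi T eta ->
      P.[m%:R%:P].[(alpha_min phi T)^-1] <= K%:R ->
      is_MBP K (inv_sqrt_congestion m) pi ->
      loss K phi T pi <=
        (C * m%:R) * (K%:R / T%:R + Num.sqrt (eta * K%:R))
        + (C * m%:R ^+ 2) * K%:R^-1.
Proof.
(* The outer variable is m and the inner one 1 / alpha; the three terms are the thresholds of the
   numerical estimates. The constant 432 comes from [small_price_error]; the terms in K / T and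
   sqrt(eta K) need only 6m and 8m. *)
exists (1297%:P%:P * 'X^2 + (256%:P * 'X^4 + 64%:P * 'X^2)%:P), 432.
move=> G K T phi eta pi m K0 T0 eta0 pv conn sv hP mbp.
have a0 := alpha_min_gt0 conn T0; have ha := alpha_min_le conn.
have hK : 1297 * m%:R ^+ 2 + 256 * alpha_min phi T ^- 4 +
    64 * alpha_min phi T ^- 2 <= K%:R.
  by move: hP; rewrite -!exprVn !hornerE.
have [Y [spread Ymin Ygap]] := fluid_prices K phi.
have [B B0 [hB1 hB2]] := block_length K T eta0.
pose w t := fluid_dual (phi t) (Y t).
have Ygap' t q : (1 <= t <= T)%N -> Omega G K q -> forall i j,
    w t + connectedness (phi t) *
      Num.max 0 (price K q i - price K q j - 2 * m%:R) <=
    fluid_dual (phi t) (price K q).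
  by move=> tT; apply: Ygap; [exact: pv|exact/ltW/conn].
have lower q Kq := mbp_value_ge K0 pv ha a0 hK mbp Ygap' (q := q) Kq.
have Yblock t : ~~ (B %| t)%N -> Y (block B t.+1) = Y (block B t).
  by case: t => [|t] nt; [rewrite dvdn0 in nt|rewrite blockS].
(* Composition with [block B] freezes the prices at the minimizer for the first period of each
   block. *)
have upper pi' q Kq := @any_value_le _ _ K phi pi' T B (Y \o block B) q pv
  (fun t => spread _) Yblock Kq.
apply: (le_trans (loss_le T0 upper lower)).
rewrite big_split /= -mulr_suml -natr_sum count_multiples //.
have dual_sum := @sum_dual_block_le _ _ T phi Y B spread Ymin B0.
have var := sum_variation_le T0 eta0 sv.
have TR : 0 < T%:R :> R by rewrite ltr0n.
set S := Num.sqrt (eta * K%:R) in hB1 hB2 *.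
set D := \sum_(1 <= t < T) _ in dual_sum var.
have drift : B.-1%:R * D <= T%:R * S.
  apply: (le_trans (ler_wpM2l _ var)) => //.
  by rewrite mulrCA ler_pM2l.
rewrite ler_pdivrMl //.
set mm : R := m%:R.
have mm0 : 0 <= mm by [].
have S0 : 0 <= T%:R * S by rewrite mulr_ge0 ?sqrtr_ge0 ?ltW.
have -> : T%:R * (432 * mm * (K%:R / T%:R + S) + 432 * mm ^+ 2 / K%:R) =
    432 * (mm * K%:R) + 432 * (mm * (T%:R * S)) + T%:R * (432 * mm ^+ 2 / K%:R).
  by field; rewrite ?pnatr_eq0 -?lt0n ?K0 ?T0.
have := ler_wpM2l mm0 drift; have := ler_wpM2l mm0 hB2.
have := mulr_ge0 mm0 S0; have : 0 <= mm * K%:R by rewrite mulr_ge0.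
move: dual_sum; rewrite -/m -/mm /w.
set X1 := \sum_(1 <= s < T.+1) _; set X2 := \sum_(1 <= s < T.+1) _.
set Z := T%:R * (432 * _ / _).
lra.
Qed.
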